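(* Let $\mathcal{H}_{1},\mathcal{H}_{2},\mathcal{H}_{3}$ be Hilbert spaces over the same field, and let $A\in\mathcal{B}(\mathcal{H}_{1},\mathcal{H}_{2})$, $U\in\mathcal{B}(\mathcal{H}_{3},\mathcal{H}_{2})$, and $V\in\mathcal{B}(\mathcal{H}_{3},\mathcal{H}_{1})$. Assume that $\mathcal{R}(A)$ is closed, let $S_{A}=I+V^{\ast}A^{\dagger}U\in\mathcal{B}(\mathcal{H}_{3},\mathcal{H}_{3})$, and assume that $\mathcal{R}(S_{A})$ and $\mathcal{R}(A+UV^{\ast})$ are closed. Put $E_{S_{A}}=I-S_{A}S_{A}^{\dagger}$ and $F_{S_{A}}=I-S_{A}^{\dagger}S_{A}$. If $\mathcal{R}(U)\subseteq \mathcal{R}(A)$ and $\mathcal{R}(V)\subseteq \mathcal{R}(A^{\ast})$, then the identity $$(A+UV^{\ast})^{\dagger}=\big(I+A^{\dagger}UF_{S_{A}}U^{\ast}(A^{\dagger})^{\ast}\big)^{-1}\big(A^{\dagger}-A^{\dagger}US_{A}^{\dagger}V^{\ast}A^{\dagger}\big)\big(I+(A^{\dagger})^{\ast}VE_{S_{A}}V^{\ast}A^{\dagger}\big)^{-1}$$ holds if and only if both $UE_{S_{A}}V^{\ast}A^{\dagger}$ and $A^{\dagger}UF_{S_{A}}V^{\ast}$ are self-adjoint and $A^{\dagger}UF_{S_{A}}E_{S_{A}}V^{\ast}A^{\dagger}=0$.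
   Context: $\mathcal{B}(\mathcal{H},\mathcal{K})$ is the set of bounded linear operators from the Hilbert space $\mathcal{H}$ into the Hilbert space $\mathcal{K}$; $I$ is the identity operator on the appropriate space. For $T\in\mathcal{B}(\mathcal{H},\mathcal{K})$, $T^{\ast}$ is the adjoint and $\mathcal{R}(T)$ the range. The Moore--Penrose inverse $T^{\dagger}\in\mathcal{B}(\mathcal{K},\mathcal{H})$, if it exists, is the unique operator $Z\in\mathcal{B}(\mathcal{K},\mathcal{H})$ with $TZT=T$, $ZTZ=Z$, $(TZ)^{\ast}=TZ$, $(ZT)^{\ast}=ZT$; it exists if and only if $\mathcal{R}(T)$ is closed. The two operators that are inverted in the formula are identity plus positive semidefinite bounded operators, hence boundedly invertible. *)

(* Defs.v *)
From HB Require Import structures.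
From mathcomp Require Import all_boot all_order all_algebra.
From mathcomp Require Import sesquilinear complex.
From mathcomp Require Import all_classical all_reals all_analysis.

Set Implicit Arguments.
Unset Strict Implicit.
Unset Printing Implicit Defensive.

Import Order.TTheory GRing.Theory Num.Theory.
Import numFieldNormedType.Exports.

Local Open Scope classical_set_scope.
Local Open Scope ring_scope.

Variant scalar_kind := RealScalars | ComplexScalars.

Definition scalars (R : realType) (k : scalar_kind) : numFieldType :=
  match k with
  | RealScalars => R : numFieldType
  | ComplexScalars => R[i] : numFieldType
  end.

Definition conj_scalars (R : realType) (k : scalar_kind) :
    scalars R k -> scalars R k :=
  match k with
  | RealScalars => fun z => z
  | ComplexScalars => @conjc R
  end.

(* [inner] is linear in its first argument and [conj]-linear in its second. *)
HB.mixin Record isHilbert (K : numFieldType) (conj : K -> K) H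
    of CompleteNormedModule K H := {
  inner : {dot H for conj};
  sqr_norm_inner : forall x : H, `|x| ^+ 2 = inner x x
}.

(* Meaningful for the pairs (K, conj) given by [scalars] and [conj_scalars]. *)
#[short(type="hilbertType")]
HB.structure Definition Hilbert (K : numFieldType) (conj : K -> K) :=
  {H of CompleteNormedModule K H & isHilbert K conj H}.

Definition bounded_linear (K : numFieldType) (E F : normedModType K) :
    {pred E -> F} :=
  fun f => `[< linear f /\ exists M : K, forall x, `|f x| <= M * `|x| >].
Arguments bounded_linear {K} E F.

Section BoundedOperators.
Context (K : numFieldType) (E F : normedModType K).

Record bop := Bop { bop_fun :> E -> F; bopP : bop_fun \in bounded_linear E F }.

HB.instance Definition _ := [isSub for bop_fun].
HB.instance Definition _ := [Choice of bop by <:].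

Lemma bounded_linear_zmod : zmod_closed (bounded_linear E F).
Proof.
split=> [|f g].
  apply/asboolP; split=> [a x y|]; first by rewrite /= scaler0 addr0.
  by exists 0 => x; rewrite normr0 mul0r.
move=> /asboolP[lf [M fM]] /asboolP[lg [N gN]]; apply/asboolP; split.
  move=> a x y; rewrite !fctE lf lg scalerBr opprD.
  by rewrite addrACA.
exists (M + N) => x; rewrite !fctE mulrDl.
by rewrite (le_trans (ler_normB _ _)) ?lerD.
Qed.

HB.instance Definition _ :=
  GRing.isZmodClosed.Build (E -> F) (bounded_linear E F) bounded_linear_zmod.
HB.instance Definition _ := [SubChoice_isSubZmodule of bop by <:].

End BoundedOperators.

Notation "''B' ( E , F )" := (bop E F) (format "''B' ( E ,  F )").

Section Composition.
Context (K : numFieldType).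

Lemma bounded_linear_comp (E F G : normedModType K) (S : 'B(F, G))
  (T : 'B(E, F)) : (fun x => S (T x)) \in bounded_linear E G.
Proof.
have /asboolP[lS [M SM]] := bopP S; have /asboolP[lT [N TN]] := bopP T.
apply/asboolP; split=> [a x y|]; first by rewrite lT lS.
exists (`|M| * `|N|) => x; have M0 (y : F) : M * `|y| <= `|M| * `|y|.
  have := SM y; have [->|y0] := eqVneq y 0; first by rewrite !normr0 !mulr0.
  move=> Sy; have My : 0 <= M * `|y| by exact: le_trans Sy.
  by rewrite -[M * _]ger0_norm// normrM normr_id.
apply: le_trans (SM _) _; apply: le_trans (M0 _) _.
rewrite -mulrA ler_wpM2l//; apply: le_trans (TN _) _.
have Nx : 0 <= N * `|x| by exact: le_trans (TN _).
by rewrite -[N * _]ger0_norm// normrM normr_id.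
Qed.

Definition bcomp (E F G : normedModType K) (S : 'B(F, G)) (T : 'B(E, F)) :
  'B(E, G) := Bop (bounded_linear_comp S T).

Lemma bounded_linear_id (E : normedModType K) :
  (fun x : E => x) \in bounded_linear E E.
Proof. by apply/asboolP; split=> //; exists 1 => x; rewrite mul1r. Qed.

Definition bid (E : normedModType K) : 'B(E, E) := Bop (bounded_linear_id E).

(* The two-sided bounded inverse; 0 if there is none. *)
Definition binv (E F : normedModType K) (T : 'B(E, F)) : 'B(F, E) :=
  xget 0 [set Z : 'B(F, E) | bcomp T Z = bid F /\ bcomp Z T = bid E].

End Composition.

Notation "S *o T" := (bcomp S T)
  (at level 40, left associativity, format "S  *o  T") : ring_scope.
Notation "\Id" := (bid _) : ring_scope.
Notation "T ^inv" := (binv T) (at level 8, format "T ^inv") : ring_scope.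

Section HilbertOperators.
Context (K : numFieldType) (conj : K -> K).

Definition is_adjoint (H G : hilbertType conj) (T : 'B(H, G)) (Z : 'B(G, H)) :=
  forall x y, inner (T x) y = inner x (Z y).

(* Every T has a unique adjoint, by the Riesz representation theorem. *)
Definition adjoint (H G : hilbertType conj) (T : 'B(H, G)) : 'B(G, H) :=
  xget 0 [set Z | is_adjoint T Z].

Definition self_adjoint (H : hilbertType conj) (T : 'B(H, H)) := adjoint T = T.

Definition is_pinv (H G : hilbertType conj) (T : 'B(H, G)) (Z : 'B(G, H)) :=
  [/\ T *o Z *o T = T, Z *o T *o Z = Z,
      self_adjoint (T *o Z) & self_adjoint (Z *o T)].

(* The Moore-Penrose inverse; 0 if there is none. *)
Definition pinv (H G : hilbertType conj) (T : 'B(H, G)) : 'B(G, H) :=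
  xget 0 [set Z | is_pinv T Z].

Definition closed_range (H G : hilbertType conj) (T : 'B(H, G)) :=
  closed (range T).

End HilbertOperators.

Notation "T ^adj" := (adjoint T) (at level 8, format "T ^adj") : ring_scope.
Notation "T ^dag" := (pinv T) (at level 8, format "T ^dag") : ring_scope.

(* Main.v *)
From HB Require Import structures.
Require Import Defs.
From mathcomp Require Import all_boot all_order all_algebra.
From mathcomp Require Import sesquilinear complex.
From mathcomp Require Import all_classical all_reals all_analysis.
From mathcomp Require Import ring.

(** Write [B = A + U V^adj], [X = A^dag U], [Y = (A^dag)^adj V], and
    [M = A^dag - X S^dag Y^adj].  The theorem rests on two observations.

    Algebra ([pinv_rank_update_iff]).  The range inclusions give [B X = U S]
    and [Y^adj B = S V^adj].  Hence [B M = A A^dag + U E Y^adj],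
    [M B = A^dag A + X F V^adj], [B M B = B] and
    [M B M = M + X F E Y^adj].  So [M] is the Moore-Penrose inverse of [B] if
    and only if the three conditions on the right-hand side hold.

    Correction factors ([pinv_absorbs_corrections]).  Since [S F = 0], the
    range of [X F] lies in the kernel of [B], to which the range of [B^dag] is
    orthogonal; since [E S = 0], the range of [Y E] lies in the kernel of
    [B^adj], which is that of [B^dag].  Therefore
    [(I + X F X^adj) B^dag (I + Y E Y^adj) = B^dag] with no condition at all.
    Multiplying the claimed formula by the two invertible factors shows that
    it says [B^dag = M], and the algebra concludes.

    The rest builds the operator theory that gives these symbols their
    meaning: adjoints ([riesz], [exists_adjoint]), bounded inverses of
    operators of the form identity plus positive ([coercive_invertible]), and
    Moore-Penrose inverses of operators with closed range ([exists_pinv]).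
    The last one needs a bound on preimages, which is drawn from
    [uniform_boundedness] applied to the adjoint. *)

Import Order.TTheory GRing.Theory Num.Theory.
Import numFieldNormedType.Exports.

Local Open Scope classical_set_scope.
Local Open Scope ring_scope.

Set Implicit Arguments.
Unset Strict Implicit.
Unset Printing Implicit Defensive.

(** * Scalars *)

(** What Hilbert space theory asks of its scalars, so that the real and the
    complex case share one development.  Norms take values in the partially
    ordered field [K] itself, so order completeness is stated in [K], for sets
    of nonnegative elements: an infimum is what minimizing a distance takes.
    The Archimedean property turns the radii 1/(n+1) into a neighbourhood
    basis, which lets sequences replace filters. *)
Record hilbert_scalars (K : numFieldType) (conj : K -> K) : Prop := {
  scalar_conjK : involutive conj;
  scalar_mul_conj : forall z, z * conj z = `|z| ^+ 2;
  scalar_archi : forall z : K, exists n : nat, `|z| < n%:R;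
  scalar_inf : forall D : set K, D !=set0 -> (forall x, D x -> 0 <= x) ->
    exists i : K, [/\ 0 <= i, forall x, D x -> i <= x &
      forall e : K, 0 < e -> exists2 x, D x & x < i + e] }.

Lemma real_inf (R : realType) (D : set R) :
  D !=set0 -> (forall x, D x -> 0 <= x) ->
  exists i : R, [/\ 0 <= i, forall x, D x -> i <= x &
    forall e : R, 0 < e -> exists2 x, D x & x < i + e].
Proof.
move=> D0 Dge0; exists (inf D).
have lbD : has_lbound D by exists 0 => x /Dge0.
split; first exact: lb_le_inf.
  by move=> x Dx; apply: ge_inf.
by move=> e e0; have [x Dx xe] := inf_adherent e0 (conj D0 lbD); exists x.
Qed.

Lemma hilbert_scalarsP (R : realType) (k : scalar_kind) :
  hilbert_scalars (@conj_scalars R k).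
Proof.
case: k; split => /=.
- by move=> x.
- by move=> x; rewrite real_normK ?num_real ?expr2.
- by move=> x; exists (Num.truncn `|x|).+1; rewrite truncnS_gt.
- exact: real_inf.
- exact: conjcK.
- by move=> z; rewrite -sqr_normc.
- move=> z; exists (Num.truncn (complex.Re `|z|)).+1.
  by rewrite -[`|z|]RRe_real ?normr_real// -(rmorph_nat (real_complex R)) ltcR truncnS_gt.
- move=> D [d Dd] Dge0.
  have DRe x : D x -> (complex.Re x)%:C%C = x by move=> /Dge0/ger0_real/RRe_real.
  have [i [i0 iD iP]] : exists i : R, [/\ 0 <= i, forall x, (@complex.Re R @` D) x -> i <= x &
      forall e : R, 0 < e -> exists2 x, (@complex.Re R @` D) x & x < i + e].
    apply: real_inf; first by exists (complex.Re d); exists d.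
    by move=> _ [x /Dge0 + <-]; rewrite lecE => /andP[].
  exists (i%:C)%C; split; first by rewrite lecR.
    by move=> x Dx; rewrite -(DRe _ Dx) lecR; apply: iD; exists x.
  move=> e e0; have eR := RRe_real (gtr0_real e0).
  have [|_ [x Dx <-] xe] := iP (complex.Re e); first by rewrite -ltcR eR.
  by exists x => //; rewrite -eR -(DRe _ Dx) -rmorphD ltcR.
Qed.

(** * Inner product inequalities *)

Section InnerProduct.
Context (K : numFieldType) (conj : K -> K) (hK : hilbert_scalars conj).
Context (H : hilbertType conj).
Implicit Types x y z : H.

Lemma innerC x y : inner x y = conj (inner y x).
Proof. by rewrite [LHS](@hermitian_subproof _ _ _ _ inner) expr0 mul1r. Qed.

Lemma innerDl x y z : inner (x + y) z = inner x z + inner y z.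
Proof. exact: linearDl. Qed.

Lemma innerDr x y z : inner x (y + z) = inner x y + inner x z.
Proof. exact: linearDr. Qed.

Lemma innerBl x y z : inner (x - y) z = inner x z - inner y z.
Proof. exact: linearBl. Qed.

Lemma innerBr x y z : inner x (y - z) = inner x y - inner x z.
Proof. exact: linearBr. Qed.

Lemma inner0l x : inner 0 x = 0.
Proof. exact: linear0l. Qed.

Lemma inner0r x : inner x 0 = 0.
Proof. exact: linear0r. Qed.

Lemma inner_eq0C x y : inner x y = 0 -> inner y x = 0.
Proof. by move=> xy; rewrite innerC xy -(inner0l (0 : H)) -innerC. Qed.

Lemma pythagoras x y : inner x y = 0 -> `|x + y| ^+ 2 = `|x| ^+ 2 + `|y| ^+ 2.
Proof.
move=> xy; rewrite !sqr_norm_inner innerDl !innerDr xy (inner_eq0C xy).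
by rewrite addr0 add0r.
Qed.

Lemma innerZl a x y : inner (a *: x) y = a * inner x y.
Proof. exact: linearZl_LR. Qed.

Lemma innerZr a x y : inner x (a *: y) = conj a * inner x y.
Proof. exact: (@linearZr_LR _ _ _ _ _ _ (@inner _ _ H) x a y). Qed.

Lemma inner_eq0 x : inner x x = 0 -> x = 0.
Proof. by rewrite -sqr_norm_inner => /eqP; rewrite sqrf_eq0 normr_eq0 => /eqP. Qed.

Lemma inner_inj x y : (forall z, inner z x = inner z y) -> x = y.
Proof.
by move=> xy; apply/eqP; rewrite -subr_eq0; apply/eqP/inner_eq0; rewrite innerBr xy subrr.
Qed.

(** The hypothesis says that [t *: y] is the orthogonal projection of [x] on
    the line of [y].  Nonnegativity of the left-hand side yields the
    Cauchy-Schwarz inequality, and minimality of [`|x|] among the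
    [`|x - t *: y|] yields orthogonality. *)
Lemma sqr_normB_line x y t : inner x y = t * inner y y ->
  `|x - t *: y| ^+ 2 = `|x| ^+ 2 - `|t| ^+ 2 * `|y| ^+ 2.
Proof.
move=> xy; rewrite !sqr_norm_inner.
rewrite innerBl !innerBr !innerZl !innerZr.
have tt : conj t * (t * inner y y) = `|t| ^+ 2 * inner y y.
  by rewrite -(scalar_mul_conj hK); ring.
have -> : t * inner y x = `|t| ^+ 2 * inner y y.
  rewrite -innerZl innerC innerZr xy tt.
  have <- : inner (t *: y) (t *: y) = `|t| ^+ 2 * inner y y.
    by rewrite innerZl innerZr -tt mulrCA.
  by rewrite -innerC.
by rewrite [t * (conj t * _)]mulrCA xy tt; ring.
Qed.

Lemma cauchy_schwarz x y : `|inner x y| <= `|x| * `|y|.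
Proof.
have [->|y0] := eqVneq y 0; first by rewrite inner0r !normr0 mulr0.
have yy : inner y y != 0 by apply: contra y0 => /eqP/inner_eq0 ->.
pose t := inner x y / inner y y.
have xy : inner x y = t * inner y y by rewrite divfK.
have := exprn_ge0 2 (normr_ge0 (x - t *: y)); rewrite sqr_normB_line// subr_ge0.
rewrite -exprMn ler_pXn2r// ?nnegrE ?mulr_ge0// => tx.
rewrite xy normrM -sqr_norm_inner normrX normr_id expr2 mulrA.
by rewrite ler_wpM2r.
Qed.

Lemma ger0_inner_le x y : 0 <= inner x y -> inner x y <= `|x| * `|y|.
Proof. by move=> /ger0_norm <-; exact: cauchy_schwarz. Qed.

Lemma parallelogram x y :
  `|x + y| ^+ 2 + `|x - y| ^+ 2 = 2 * (`|x| ^+ 2 + `|y| ^+ 2).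
Proof.
by rewrite !sqr_norm_inner !(innerBl, innerBr, innerDl, innerDr); ring.
Qed.

End InnerProduct.

(** * Sequences in normed spaces *)

Section Sequences.
Context (K : numFieldType) (conj : K -> K) (hK : hilbert_scalars conj).
Context (E : normedModType K).
Implicit Types u : nat -> E.

Definition tends u l :=
  forall e : K, 0 < e -> exists N : nat, forall n, (N <= n)%N -> `|u n - l| < e.

Lemma tends_cauchy u l (e : K) : tends u l -> 0 < e ->
  exists N : nat, forall m n, (N <= m)%N -> (N <= n)%N -> `|u m - u n| < e.
Proof.
move=> ul e0; have e20 : 0 < e / 2 by rewrite divr_gt0.
have [N uN] := ul _ e20; exists N => m n Nm Nn.
rewrite -(subrKA l) (le_lt_trans (ler_normD _ _))// [X in _ < X]splitr.
by rewrite ltrD ?uN// distrC uN.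
Qed.

Lemma tends_uniq u l l' : tends u l -> tends u l' -> l = l'.
Proof.
move=> ul ul'; apply/eqP; rewrite -subr_eq0 -normr_le0.
apply/ler_addgt0Pl => e e0; rewrite addr0.
have e20 : 0 < e / 2 by rewrite divr_gt0.
have [N uN] := ul _ e20; have [N' uN'] := ul' _ e20; pose n := maxn N N'.
rewrite -(subrKA (u n)) (le_trans (ler_normD _ _))// [leRHS]splitr distrC.
by rewrite lerD// ltW// ?uN ?uN'// ?leq_maxl ?leq_maxr.
Qed.

Lemma closed_tends (D : set E) u l :
  closed D -> (forall n, D (u n)) -> tends u l -> D l.
Proof.
move=> cD Du ul; suff cul : u @ \oo --> l by apply: (closed_cvg _ cD) cul; exact: nearW.
apply/cvgrPdist_lt => e /ul[N uN]; exists N => // n /= Nn.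
by rewrite distrC uN.
Qed.

Lemma inv_succ_lt (e : K) : 0 < e ->
  exists N : nat, forall n, (N <= n)%N -> n.+1%:R^-1 < e.
Proof.
move=> e0; have [N] := scalar_archi hK e^-1.
rewrite gtr0_norm ?invr_gt0// => eN; exists N => n Nn.
rewrite -[e]invrK ltf_pV2 ?posrE ?invr_gt0//.
by rewrite (lt_le_trans eN)// ler_nat (leq_trans Nn).
Qed.

Lemma tends_closed (D : set E) :
  (forall u l, (forall n, D (u n)) -> tends u l -> D l) -> closed D.
Proof.
move=> Dt l Dl.
have inv_gt0 n : 0 < n.+1%:R^-1 :> K by rewrite invr_gt0 ltr0n.
have /choice[u uP] : forall n : nat, exists x, D x /\ `|x - l| < n.+1%:R^-1.
  move=> n; have [x [Dx]] := Dl _ (nbhsx_ballx l _ (inv_gt0 n)).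
  by rewrite -ball_normE/= distrC; exists x.
apply: (Dt u); first by move=> n; have [] := uP n.
move=> e /inv_succ_lt[N eN]; exists N => n Nn.
have [_ /lt_trans] := uP n; apply; exact: eN.
Qed.

End Sequences.

Lemma cauchy_tends (K : numFieldType) (E : completeNormedModType K) (u : nat -> E) :
  (forall e : K, 0 < e -> exists N : nat,
     forall m n, (N <= m)%N -> (N <= n)%N -> `|u m - u n| < e) ->
  exists l, tends u l.
Proof.
move=> uC; have : cvg (u @ \oo).
  apply: cauchy_cvg; apply: cauchy_exP => e /uC[N uN].
  exists (u N); exists N => // n /= Nn; rewrite -ball_normE/=; exact: uN.
move=> /cvg_ex[l /cvgrPdist_lt ul]; exists l => e /ul [N _ uN].
by exists N => n Nn; rewrite distrC; apply: uN.
Qed.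

(** * Projection on a closed subspace, and the Riesz representation *)

Section Projection.
Context (K : numFieldType) (conj : K -> K) (hK : hilbert_scalars conj).
Context (H : hilbertType conj).
Implicit Types (M : set H) (x y z : H).

Definition subspace M := M 0 /\ forall a x y, M x -> M y -> M (a *: x + y).

(** A minimizing sequence is Cauchy: midpoints stay in the subspace, hence at
    distance at least [d] from [x], and the parallelogram law then bounds the
    distance between two terms that nearly realize the infimum [d]. *)
Lemma nearest_point M x : closed M -> subspace M ->
  exists2 m, M m & forall z, M z -> `|x - m| <= `|x - z|.
Proof.
move=> cM [M0 Mlin].
have [] := @scalar_inf _ _ hK [set `|x - z| | z in M].
- by exists `|x - 0|; exists 0.
- by move=> _ [z _ <-].
move=> d [d0 dM dinf].
have inv_gt0 n : 0 < n.+1%:R^-1 :> K by rewrite invr_gt0 ltr0n.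
have /choice[u uP] : forall n : nat, exists z, M z /\ `|x - z| < d + n.+1%:R^-1.
  by move=> n; have [_ [z Mz <-] zd] := dinf _ (inv_gt0 n); exists z.
have uM n : M (u n) by have [] := uP n.
have u_bound p n : (p <= n)%N -> `|x - u n| ^+ 2 <= (d + p.+1%:R^-1) ^+ 2.
  move=> pn; rewrite ler_pXn2r ?nnegrE ?addr_ge0 ?(ltW (inv_gt0 _))//.
  have [_ /ltW/le_trans] := uP n; apply.
  by rewrite lerD2l lef_pV2 ?posrE ?ltr0n// ler_nat.
have [] := @cauchy_tends _ _ u.
  move=> e e0.
  (* If both distances are at most d + c with c <= 1, the squared gap is at
     most 4 (d + c)^2 - 4 d^2 = c (8 d + 4 c) <= c (8 d + 4). *)
  have e'0 : 0 < e ^+ 2 / (8 * d + 4).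
    by rewrite divr_gt0 ?exprn_gt0 ?ltr_wpDl ?mulr_ge0.
  have [p eN] := inv_succ_lt hK e'0.
  exists p => m n pm pn.
  have := eN _ (leqnn p); rewrite ltr_pdivlMr; last by rewrite ltr_wpDl ?mulr_ge0.
  set c := p.+1%:R^-1 => ce; have c0 : 0 < c by exact: inv_gt0.
  have c1 : c <= 1 by rewrite invf_le1 ?ltr0n// ler1n.
  rewrite -(@ltr_pXn2r _ 2)// ?nnegrE ?(ltW e0)//.
  have mid : (2 * d) ^+ 2 <= `|(x - u n) + (x - u m)| ^+ 2.
    rewrite ler_pXn2r ?nnegrE ?mulr_ge0//.
    have : d <= `|x - 2^-1 *: (u n + u m)|.
      apply: dM; exists (2^-1 *: (u n + u m)) => //.
      by rewrite scalerDr; apply: (Mlin) => //; rewrite -[_ *: _]addr0; apply: (Mlin).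
    rewrite -(ler_pM2l (ltr0Sn K 1) d) => /le_trans; apply.
    rewrite -[X in X * _ <= _](@ger0_norm K 2)// -normrZ scalerBr scalerA.
    by rewrite mulfV ?pnatr_eq0// scale1r scaler_nat mulr2n opprD addrACA.
  have := parallelogram (x - u n) (x - u m).
  have -> : (x - u n) - (x - u m) = u m - u n.
    by rewrite opprB addrC addrA subrK.
  move=> para; have {para}-> : `|u m - u n| ^+ 2 =
      2 * (`|x - u n| ^+ 2 + `|x - u m| ^+ 2) - `|(x - u n) + (x - u m)| ^+ 2.
    by rewrite -para; ring.
  apply: (@le_lt_trans _ _ (2 * ((d + c) ^+ 2 + (d + c) ^+ 2) - (2 * d) ^+ 2)).
    by rewrite lerB// ler_pM2l// lerD// u_bound.
  apply: le_lt_trans ce.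
  have -> : 2 * ((d + c) ^+ 2 + (d + c) ^+ 2) - (2 * d) ^+ 2 = c * (8 * d + 4 * c).
    by ring.
  by rewrite ler_pM2l// lerD2l -[leRHS]mulr1 ler_pM2l.
move=> l ul; exists l; first exact: closed_tends ul.
move=> z Mz; have : d <= `|x - z| by apply: dM; exists z.
apply: le_trans; apply/ler_addgt0Pl => e e0.
have e20 : 0 < e / 2 by rewrite divr_gt0.
have [N1 uN1] := ul _ e20; have [N2 uN2] := inv_succ_lt hK e20.
pose n := maxn N1 N2.
rewrite -(subrKA (u n) x) (le_trans (ler_normD _ _))//.
have [_ xu] := uP n.
have := uN1 n (leq_maxl _ _); have := uN2 n (leq_maxr _ _) => n2 n1.
apply: ltW; apply: lt_le_trans (ltrD xu n1) _.
rewrite -addrA addrC lerD2r [leRHS](splitr e) lerD2r; exact: ltW.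
Qed.

Lemma projection M x : closed M -> subspace M ->
  exists2 m, M m & forall z, M z -> inner (x - m) z = 0.
Proof.
move=> cM sM; have [m Mm mP] := nearest_point x cM sM; exists m => // z Mz.
have [->|z0] := eqVneq z 0; first exact: inner0r.
have zz : inner z z != 0 by apply: contra z0 => /eqP/inner_eq0 ->.
pose t := inner (x - m) z / inner z z.
have xz : inner (x - m) z = t * inner z z by rewrite divfK.
have : `|x - m| ^+ 2 <= `|x - m - t *: z| ^+ 2.
  rewrite ler_pXn2r ?nnegrE//; rewrite -addrA -opprD; apply: mP.
  by rewrite addrC; apply: sM.2.
rewrite sqr_normB_line// lerDl oppr_ge0 -exprMn => tz.
have : (`|t| * `|z|) ^+ 2 == 0 by rewrite eq_le tz exprn_ge0// mulr_ge0.
by rewrite sqrf_eq0 mulf_eq0 !normr_eq0 (negPf z0) orbF xz => /eqP->; rewrite mul0r.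
Qed.

(** The kernel of [f] is closed, and a vector [r] orthogonal to it with
    [f r != 0] spans its orthogonal complement; the representing vector is the
    multiple of [r] that gives the right value at [r]. *)
Lemma riesz (f : H -> K) (C : K) :
  0 < C -> (forall a x y, f (a *: x + y) = a * f x + f y) ->
  (forall x, `|f x| <= C * `|x|) -> exists y, forall x, f x = inner x y.
Proof.
move=> C0 flin fC.
have f0 : f 0 = 0.
  by have := fC 0; rewrite normr0 mulr0 normr_le0 => /eqP.
have fZ a x : f (a *: x) = a * f x by rewrite -[_ *: x]addr0 flin f0 addr0.
have fB x y : f (x - y) = f x - f y.
  by rewrite addrC -scaleN1r flin mulN1r addrC.
pose M := [set x | f x = 0].
have sM : subspace M.
  by split=> [|a x y]; rewrite /M/= ?f0// flin => -> ->; rewrite mulr0 addr0.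
have cM : closed M.
  apply: (tends_closed hK) => u l Mu ul; apply/eqP; rewrite -normr_le0.
  apply/ler_addgt0Pl => e e0; rewrite addr0.
  have [p up] := ul _ (divr_gt0 e0 C0).
  have -> : f l = f (l - u p) by rewrite fB Mu subr0.
  apply: le_trans (fC _) _.
  by have := up p (leqnn p); rewrite ltr_pdivlMr// distrC mulrC => /ltW.
have [fz|/existsNP[x0 fx0]] := pselect (forall x, f x = 0).
  by exists 0 => x; rewrite inner0r fz.
have [m Mm mP] := projection x0 cM sM; pose r := x0 - m.
have fr : f r != 0 by rewrite fB Mm subr0; apply/eqP.
have rr : inner r r != 0.
  by apply: contra fr => /eqP/inner_eq0 ->; rewrite f0.
exists (conj (f r / inner r r) *: r) => x.
rewrite innerZr scalar_conjK//.
have : inner r (x - f x / f r *: r) = 0.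
  by apply: mP; rewrite /M/= fB fZ divfK// subrr.
move=> /inner_eq0C/eqP.
rewrite innerBl innerZl subr_eq0 => /eqP ->.
by field; rewrite rr fr.
Qed.

End Projection.

(** * Bounded operators, adjoints and coercive operators *)

Section Operators.
Context (K : numFieldType).
Implicit Types E F G : normedModType K.

Lemma bop_ext E F (S T : 'B(E, F)) : (forall x, S x = T x) -> S = T.
Proof. by move=> ST; apply/val_inj/funext. Qed.

Lemma bop_lin E F (T : 'B(E, F)) a x y : T (a *: x + y) = a *: T x + T y.
Proof. by have /asboolP[lT _] := bopP T; exact: lT. Qed.

Lemma bopD E F (T : 'B(E, F)) x y : T (x + y) = T x + T y.
Proof. by rewrite -[x in LHS]scale1r bop_lin scale1r. Qed.

Lemma bop0 E F (T : 'B(E, F)) : T 0 = 0.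
Proof. by apply: (addIr (T 0)); rewrite -bopD !add0r. Qed.

Lemma bopZ E F (T : 'B(E, F)) a x : T (a *: x) = a *: T x.
Proof. by rewrite -[a *: x]addr0 bop_lin bop0 addr0. Qed.

Lemma bopB E F (T : 'B(E, F)) x y : T (x - y) = T x - T y.
Proof. by rewrite -scaleN1r bopD bopZ scaleN1r. Qed.

Lemma bop_bound E F (T : 'B(E, F)) :
  exists2 C : K, 0 < C & forall x, `|T x| <= C * `|x|.
Proof.
have /asboolP[_ [M TM]] := bopP T; exists (`|M| + 1) => [|x].
  by rewrite ltr_wpDl.
have Mx : 0 <= M * `|x| by exact: le_trans (TM x).
rewrite (le_trans (TM x))// mulrDl -[leLHS]ger0_norm// normrM normr_id.
by rewrite lerDl mul1r.
Qed.

Lemma tends_bop E F (T : 'B(E, F)) (u : nat -> E) l :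
  tends u l -> tends (fun n => T (u n)) (T l).
Proof.
move=> ul e e0; have [C C0 TC] := bop_bound T.
have [N uN] := ul _ (divr_gt0 e0 C0); exists N => n /uN.
by rewrite ltr_pdivlMr// mulrC -bopB; exact/le_lt_trans.
Qed.

Lemma exists_bop E F (f : E -> F) (C : K) :
  (forall a x y, f (a *: x + y) = a *: f x + f y) ->
  (forall x, `|f x| <= C * `|x|) -> exists T : 'B(E, F), forall x, T x = f x.
Proof.
move=> flin fC; have fb : f \in bounded_linear E F.
  by apply/asboolP; split=> [a x y|]; [exact: flin | exists C].
by exists (Bop fb).
Qed.

Lemma range_subspace E F (T : 'B(E, F)) :
  [/\ range T 0 & forall a x y, range T x -> range T y -> range T (a *: x + y)].
Proof.
split=> [|a _ _ [x _ <-] [y _ <-]]; first by exists 0; rewrite ?bop0.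
by exists (a *: x + y); rewrite ?bop_lin.
Qed.

End Operators.

Section HilbertOperatorTheory.
Context (K : numFieldType) (conj : K -> K) (hK : hilbert_scalars conj).
Implicit Types H G : hilbertType conj.

Lemma sqr_le_mul (a b : K) : 0 <= a -> 0 <= b -> b ^+ 2 <= a * b -> b <= a.
Proof.
move=> a0; rewrite le_eqVlt => /predU1P[<- _//|b0].
by rewrite expr2 ler_pM2r.
Qed.

Lemma exists_adjoint H G (T : 'B(H, G)) : exists Z, is_adjoint T Z.
Proof.
have [C C0 TC] := bop_bound T.
have /choice[f fP] : forall y, exists z, forall x, inner (T x) y = inner x z.
  move=> y.
  apply: (@riesz _ _ hK H (fun x => inner (T x) y) (C * (`|y| + 1))).
  - by rewrite mulr_gt0// ltr_wpDl.
  - by move=> a x x'; rewrite bop_lin innerDl innerZl.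
  - move=> x; apply: le_trans (cauchy_schwarz hK _ _) _.
    rewrite mulrAC ler_pM// lerDl//.
have [||Z ZE] := @exists_bop _ _ _ f C.
- move=> a y z; apply: inner_inj => x.
  by rewrite innerDr innerZr -!fP innerDr innerZr.
- move=> y; apply: sqr_le_mul; rewrite ?mulr_ge0 ?(ltW C0)//.
  have := @ger0_inner_le _ _ hK _ (T (f y)) y.
  rewrite fP -sqr_norm_inner exprn_ge0// => /(_ isT) /le_trans; apply.
  by rewrite [leRHS]mulrAC ler_wpM2r.
by exists Z => x y; rewrite ZE.
Qed.

Lemma adjointP H G (T : 'B(H, G)) : is_adjoint T T^adj.
Proof.
have [Z TZ] := exists_adjoint T.
by rewrite /adjoint; case: xgetP => [//|/(_ Z)].
Qed.

Lemma adjoint_uniq H G (T : 'B(H, G)) Z : is_adjoint T Z -> T^adj = Z.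
Proof.
move=> TZ; apply: bop_ext => y; apply: inner_inj => x.
by rewrite -adjointP TZ.
Qed.

Lemma exists_orth_projector H (M : set H) : closed M -> subspace M ->
  exists P : 'B(H, H), (forall x, M (P x)) /\
    forall x z, M z -> inner (x - P x) z = 0.
Proof.
move=> cM sM.
have /choice[p pP] : forall x, exists m, M m /\ forall z, M z -> inner (x - m) z = 0.
  by move=> x; have [m] := projection hK x cM sM; exists m.
have pM x : M (p x) by have [] := pP x.
have pO x z : M z -> inner (x - p x) z = 0 by have [_] := pP x; apply.
have MB x y : M x -> M y -> M (x - y).
  by move=> Mx My; rewrite addrC -scaleN1r; apply: sM.2.
have [||P PE] := @exists_bop _ _ _ p 1.
- move=> a x y; apply/eqP; rewrite -subr_eq0; apply/eqP/inner_eq0.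
  set z := (X in inner X X); have Mz : M z by apply: MB => //; apply: sM.2.
  have -> : inner z z = inner (a *: (x - p x) + (y - p y) - (a *: x + y - p (a *: x + y))) z.
    congr (inner _ z); rewrite /z scalerBr; move: (p (a *: x + y)) => q.
    by rewrite [in RHS]opprB (addrACA (a *: x)) -opprD [RHS]addrC subrKA.
  by rewrite innerBl innerDl innerZl !pO// mulr0 addr0 subrr.
- move=> x; rewrite mul1r; apply: sqr_le_mul => //.
  have pxx : inner x (p x) = inner (p x) (p x).
    by apply/eqP; rewrite -subr_eq0 -innerBl pO.
  by rewrite sqr_norm_inner -pxx ger0_inner_le// pxx -sqr_norm_inner exprn_ge0.
by exists P; split=> [x|x z Mz]; rewrite PE//; apply: pO.
Qed.

(** Coercivity bounds [D] below, so [D] is injective with closed range, and it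
    leaves no nonzero vector orthogonal to the range.  This single criterion
    serves both the operators inverted in the formula and the construction of
    Moore-Penrose inverses. *)
Lemma coercive_invertible H (D : 'B(H, H)) (c : K) : 0 < c ->
  (forall x, c * `|x| ^+ 2 <= inner (D x) x) ->
  exists Z : 'B(H, H), D *o Z = \Id /\ Z *o D = \Id.
Proof.
move=> c0 Dc.
have Dlb x : c * `|x| <= `|D x|.
  have [->|x0] := eqVneq x 0; first by rewrite normr0 mulr0.
  rewrite -(@ler_pM2r _ `|x|) ?normr_gt0// -mulrA -expr2.
  apply: le_trans (cauchy_schwarz hK _ _).
  have := Dc x; move/le_trans; apply; rewrite real_ler_norm// ger0_real//.
  by rewrite (le_trans _ (Dc x))// mulr_ge0 ?exprn_ge0// ltW.
have Dinj x y : D x = D y -> x = y.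
  move=> xy; apply/eqP; rewrite -subr_eq0 -normr_le0 -(@ler_pM2l _ c)// mulr0.
  by rewrite (le_trans (Dlb _))// bopB xy subrr normr0.
have cD : closed (range D).
  apply: (tends_closed hK) => u l uD ul.
  have /choice[v vP] : forall n, exists x, D x = u n.
    by move=> n; have [x _ <-] := uD n; exists x.
  have [|x vx] := @cauchy_tends _ _ v.
    move=> e e0; have [N uN] := tends_cauchy ul (mulr_gt0 c0 e0).
    exists N => m n Nm Nn; rewrite -(ltr_pM2l c0).
    by rewrite (le_lt_trans (Dlb _))// bopB !vP uN.
  exists x => //; have := tends_bop D vx.
  have -> : (fun n => D (v n)) = u by apply/funext.
  by move=> /tends_uniq; apply.
have surj y : exists x, D x = y.
  have [_ [x _ <-] mP] := projection hK y cD (range_subspace D).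
  have Dw : inner (D (y - D x)) (y - D x) = 0.
    by apply: inner_eq0C; apply: mP; exists (y - D x).
  exists x; apply/esym/eqP; rewrite -subr_eq0 -normr_eq0 -sqrf_eq0.
  have := Dc (y - D x); rewrite Dw pmulr_rle0// => w0.
  by rewrite eq_le w0 exprn_ge0.
have [f fK] := choice surj.
have [||Z ZE] := @exists_bop _ _ _ f c^-1.
- by move=> a x y; apply: Dinj; rewrite bop_lin !fK.
- by move=> y; rewrite ler_pdivlMl// (le_trans (Dlb _))// fK.
by exists Z; split; apply: bop_ext => x /=; rewrite ZE ?fK//; apply: Dinj; rewrite fK.
Qed.

End HilbertOperatorTheory.

(** * Algebra of composition and adjunction *)

Section OperatorAlgebra.
Context (K : numFieldType).
Implicit Types E F G L : normedModType K.

Lemma bcompA E F G L (S : 'B(G, L)) (T : 'B(F, G)) (Q : 'B(E, F)) :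
  S *o (T *o Q) = S *o T *o Q.
Proof. exact: bop_ext. Qed.

Lemma bcompDl E F G (S S' : 'B(F, G)) (T : 'B(E, F)) :
  (S + S') *o T = S *o T + S' *o T.
Proof. exact: bop_ext. Qed.

Lemma bcompDr E F G (S : 'B(F, G)) (T T' : 'B(E, F)) :
  S *o (T + T') = S *o T + S *o T'.
Proof. by apply: bop_ext => x; apply: bopD. Qed.

Lemma bcompBl E F G (S S' : 'B(F, G)) (T : 'B(E, F)) :
  (S - S') *o T = S *o T - S' *o T.
Proof. exact: bop_ext. Qed.

Lemma bcompBr E F G (S : 'B(F, G)) (T T' : 'B(E, F)) :
  S *o (T - T') = S *o T - S *o T'.
Proof. by apply: bop_ext => x; apply: bopB. Qed.

Lemma bcomp0l E F G (T : 'B(E, F)) : (0 : 'B(F, G)) *o T = 0.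
Proof. exact: bop_ext. Qed.

Lemma bcomp0r E F G (S : 'B(F, G)) : S *o (0 : 'B(E, F)) = 0.
Proof. by apply: bop_ext => x; apply: bop0. Qed.

Lemma bcomp1l E F (T : 'B(E, F)) : \Id *o T = T.
Proof. exact: bop_ext. Qed.

Lemma bcomp1r E F (T : 'B(E, F)) : T *o \Id = T.
Proof. exact: bop_ext. Qed.

End OperatorAlgebra.

Section AdjointAlgebra.
Context (K : numFieldType) (conj : K -> K) (hK : hilbert_scalars conj).
Implicit Types H G L : hilbertType conj.

Lemma adjointD H G (S T : 'B(H, G)) : (S + T)^adj = S^adj + T^adj.
Proof.
apply: (adjoint_uniq hK) => x y.
by rewrite innerDl innerDr !(adjointP hK).
Qed.

Lemma adjointB H G (S T : 'B(H, G)) : (S - T)^adj = S^adj - T^adj.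
Proof.
apply: (adjoint_uniq hK) => x y.
by rewrite innerBl innerBr !(adjointP hK).
Qed.

Lemma adjoint_comp H G L (S : 'B(G, L)) (T : 'B(H, G)) :
  (S *o T)^adj = T^adj *o S^adj.
Proof. by apply: (adjoint_uniq hK) => x y; rewrite /= !(adjointP hK). Qed.

Lemma adjoint_id H : (\Id : 'B(H, H))^adj = \Id.
Proof. exact: (adjoint_uniq hK). Qed.

Lemma adjointK H G (T : 'B(H, G)) : T^adj^adj = T.
Proof.
by apply: (adjoint_uniq hK) => x y; rewrite innerC -(adjointP hK) -innerC.
Qed.

Lemma adjoint0 H G : (0 : 'B(H, G))^adj = 0.
Proof. by apply: (adjoint_uniq hK) => x y; rewrite inner0l inner0r. Qed.

End AdjointAlgebra.

(** * Uniform boundedness *)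

Section UniformBoundedness.
Context (K : numFieldType) (conj : K -> K) (hK : hilbert_scalars conj).
Context (H : hilbertType conj).
Implicit Types x w : H.

(** Moving [x] by [z] and by [- z], with [z] of length [r] along [w], changes
    the product with [w] by [2 * r * `|w|] in all; one of the two moves must
    land at [r * `|w|] or more. *)
Lemma large_inner_nearby x w (r : K) : 0 <= r ->
  exists x', `|x' - x| <= r /\ r * `|w| <= `|inner x' w|.
Proof.
move=> r0; have [->|w0] := eqVneq w 0.
  by exists x; rewrite subrr normr0 mulr0.
pose z := (r / `|w|) *: w.
have zr : `|z| = r by rewrite normrZ normrM normfV normr_id ger0_norm// divfK ?normr_eq0.
have zw : inner z w = r * `|w|.
  by rewrite innerZl -sqr_norm_inner expr2 mulrA divfK ?normr_eq0.
have [h|h] := real_leP (ger0_real (mulr_ge0 r0 (normr_ge0 w))) (normr_real (inner (x + z) w)).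
  by exists (x + z); rewrite addrC addKr zr.
exists (x - z); rewrite addrC addKr normrN zr; split=> //.
have : 2 * (r * `|w|) <= `|inner (x + z) w| + `|inner (x - z) w|.
  rewrite -[leLHS]ger0_norm ?mulr_ge0//.
  have -> : 2 * (r * `|w|) = inner (x + z) w - inner (x - z) w.
    by rewrite innerBl innerDl zw; ring.
  exact: ler_normB.
rewrite mulr_natl mulr2n => /le_trans/(_ (lerD (ltW h) (lexx _))).
by rewrite lerD2l.
Qed.

(** Gliding hump argument.  If [W] were unbounded, one could choose [w n] in
    [W] so large, and steps of length 3^-n such, that the product of the
    current point with [w n] has size 3^-n |w n|; all later steps together have
    length at most 3^-n / 2, so the limit [l] keeps half of that product, and
    the products of [l] with the [w n] are unbounded. *)
Lemma uniform_boundedness (W : set H) :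
  (forall x, exists M : K, forall w, W w -> `|inner x w| <= M) ->
  exists C : K, forall w, W w -> `|w| <= C.
Proof.
move=> Wx; apply: contrapT => Wunb.
have large (n : nat) : exists w, W w /\ n%:R < `|w| :> K.
  apply: contrapT => nW; apply: Wunb; exists n%:R => w Ww.
  by rewrite real_leNgt ?normr_real ?realn//; apply/negP => wn; apply: nW; exists w.
(* With |w n| > 2 n 3^n, half of the hump 3^-n |w n| exceeds n. *)
have /choice[w wP] : forall n : nat, exists w, W w /\ (n * 2 * 3 ^ n)%:R < `|w| :> K.
  by move=> n; apply: large.
pose r n : K := 3 ^- n.
have r_ge0 n : 0 <= r n by rewrite invr_ge0 exprn_ge0.
have /choice[g gP] : forall nx : nat * H, exists x',
    `|x' - nx.2| <= r nx.1 /\ r nx.1 * `|w nx.1| <= `|inner x' (w nx.1)|.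
  by move=> [n x]; apply: large_inner_nearby.
pose fix x n := if n is n'.+1 then g (n', x n') else 0.
have step n : `|x n.+1 - x n| <= r n by have [] := gP (n, x n).
have hump n : r n * `|w n| <= `|inner (x n.+1) (w n)| by have [] := gP (n, x n).
(* The tail of a geometric series: the sum over n <= k < n + p of 3^-k. *)
have tail n p : `|x (n + p)%N - x n| <= 3 / 2 * (r n - r (n + p)%N).
  elim: p => [|p IHp]; first by rewrite addn0 !subrr normr0 mulr0.
  rewrite -(subrKA (x (n + p)%N)) (le_trans (ler_normD _ _))// addnS.
  apply: le_trans (lerD (step _) IHp) _.
  rewrite /r exprS invfM -/(r n) -/(r (n + p)%N).
  by rewrite le_eqVlt; apply/orP; left; apply/eqP; field.
have tailr m n : (n <= m)%N -> `|x m - x n| <= 3 / 2 * r n.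
  move=> /subnKC <-; apply: le_trans (tail _ _) _.
  by rewrite ler_wpM2l ?divr_ge0// gerBl.
have [|l xl] := @cauchy_tends _ _ x.
  move=> e e0; have [N eN] := inv_succ_lt hK (divr_gt0 e0 (ltr0Sn K 2)).
  have rN : r N < e / 3.
    apply: le_lt_trans (eN _ (leqnn N)).
    by rewrite lef_pV2 ?posrE ?exprn_gt0 ?ltr0n// -natrX ler_nat ltn_expl.
  exists N => m n Nm Nn; rewrite -(subrKA (x N)) (le_lt_trans (ler_normD _ _))//.
  rewrite (distrC (x N)) (le_lt_trans (lerD (tailr _ _ Nm) (tailr _ _ Nn)))//.
  rewrite -mulrDl -splitr mulrC -ltr_pdivlMr//.
have limit_dist n : `|l - x n| <= 3 / 2 * r n.
  apply/ler_addgt0Pl => e /xl[N xN]; pose m := maxn N n.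
  rewrite -(subrKA (x m)) (le_trans (ler_normD _ _))// lerD//.
    by rewrite distrC ltW// xN// leq_maxl.
  exact/tailr/leq_maxr.
have [M MP] := Wx l; have [n nM] := scalar_archi hK M.
have [Wn wn] := wP n.
have rn_gt0 : 0 < r n by rewrite invr_gt0 exprn_gt0.
have M0 : 0 <= M by apply: le_trans (MP _ Wn).
have half : r n * `|w n| <= r n / 2 * `|w n| + M.
  apply: le_trans (hump n) _; rewrite -[x n.+1](subrK l) innerDl.
  apply: le_trans (ler_normD _ _) _; apply: lerD (MP _ Wn).
  apply: le_trans (cauchy_schwarz hK _ _) _; rewrite ler_wpM2r// distrC.
  apply: le_trans (limit_dist _) _; rewrite /r exprS invfM -/(r n).
  by rewrite le_eqVlt; apply/orP; left; apply/eqP; field.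
have : r n / 2 * `|w n| <= M.
  rewrite -(lerD2l (r n / 2 * `|w n|)); apply: le_trans half.
  by rewrite -mulrDl -splitr.
suff /lt_le_trans/[apply] : M < r n / 2 * `|w n| by rewrite ltxx.
rewrite -(ger0_norm M0) (lt_trans nM)//.
rewrite -(ltr_pM2l (divr_gt0 rn_gt0 (ltr0Sn K 1))) in wn.
apply: le_lt_trans wn; rewrite !natrM natrX.
rewrite le_eqVlt; apply/orP; left; apply/eqP; rewrite /r.
by field; rewrite expf_neq0.
Qed.

End UniformBoundedness.

(** * Moore-Penrose inverses of operators with closed range *)

Section MoorePenrose.
Context (K : numFieldType) (conj : K -> K) (hK : hilbert_scalars conj).
Implicit Types H G : hilbertType conj.

(** The vectors [w] of the range with [`|A^adj w| <= 1] are pointwise bounded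
    as functionals: the projection of [y] on the range is some [A x], so that
    [inner y w = inner x (A^adj w)].  Uniform boundedness then plays the part
    of the open mapping theorem. *)
Lemma adjoint_bounded_below H G (A : 'B(H, G)) : closed_range A ->
  exists2 C : K, 0 < C & forall w, range A w -> `|w| <= C * `|A^adj w|.
Proof.
move=> cA.
have [P [PA PO]] := exists_orth_projector hK cA (range_subspace A).
have [|C CP] := @uniform_boundedness _ _ hK G [set w | range A w /\ `|A^adj w| <= 1].
  move=> y; have [x _ xP] := PA y; exists `|x| => w [Aw w1].
  have -> : inner y w = inner x (A^adj w).
    rewrite -(adjointP hK) xP; apply/eqP; rewrite -subr_eq0 -innerBl PO//.
  by rewrite (le_trans (cauchy_schwarz hK _ _))// ler_piMr.
exists (`|C| + 1); first by rewrite ltr_wpDl.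
move=> w Aw; have [Aw0|Aw0] := eqVneq (A^adj w) 0.
  suff -> : w = 0 by rewrite bop0 !normr0 mulr0.
  apply: inner_eq0; case: (Aw) => x _ xw.
  by rewrite -{1}xw (adjointP hK) Aw0 inner0r.
have nA : 0 < `|A^adj w| by rewrite normr_gt0.
have : `|(`|A^adj w|^-1) *: w| <= C.
  apply: CP; split.
    by rewrite -[_ *: w]addr0; apply: (range_subspace A).2 => //; apply: (range_subspace A).1.
  by rewrite bopZ normrZ normfV normr_id mulVf// gt_eqF.
rewrite normrZ normfV normr_id ler_pdivrMl// mulrC => wC.
have C0 : 0 <= C * `|A^adj w| by exact: le_trans wC.
rewrite (le_trans wC)// -[leLHS]ger0_norm// normrM normr_id ler_pM2r//.
by rewrite lerDl.
Qed.

End MoorePenrose.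

Section MoorePenroseTheory.
Context (K : numFieldType) (conj : K -> K) (hK : hilbert_scalars conj).
Implicit Types H G : hilbertType conj.

Lemma binvP (E F : normedModType K) (T : 'B(E, F)) :
  (exists Z : 'B(F, E), T *o Z = \Id /\ Z *o T = \Id) ->
  T *o T^inv = \Id /\ T^inv *o T = \Id.
Proof. by move=> [Z TZ]; rewrite /binv; case: xgetP => [//|/(_ Z)]. Qed.

Lemma invertible_id_add_sqr H G (T : 'B(H, G)) (D := \Id + T *o T^adj) :
  D *o D^inv = \Id /\ D^inv *o D = \Id.
Proof.
apply: binvP; apply: (coercive_invertible hK ltr01) => x.
rewrite mul1r -[X in inner X _]/(x + T (T^adj x)) innerDl (adjointP hK).
by rewrite -!sqr_norm_inner lerDl exprn_ge0.
Qed.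

(** With [P] the orthogonal projector on the range, [D = A A^adj + (I - P)] is
    coercive because [A^adj] is bounded below on the range, and it commutes with
    [P] since [P D = A A^adj = D P].  The Moore-Penrose inverse is
    [A^adj D^-1]. *)
Lemma exists_pinv H G (A : 'B(H, G)) : closed_range A -> exists Z, is_pinv A Z.
Proof.
move=> cA; have [P [PA PO]] := exists_orth_projector hK cA (range_subspace A).
have Pfix z : range A z -> P z = z.
  move=> Az; apply/esym/eqP; rewrite -subr_eq0; apply/eqP/inner_eq0.
  rewrite PO// addrC -[- P z]scaleN1r; exact: (range_subspace A).2.
have PAA : P *o A = A by apply: bop_ext => x /=; rewrite Pfix//; exists x.
have PP : P *o P = P by apply: bop_ext => x /=; rewrite Pfix.
have Psa : P^adj = P.
  apply: (adjoint_uniq hK) => x y; apply: (@etrans _ _ (inner (P x) (P y))).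
    by apply/eqP; rewrite -subr_eq0 -innerBr; apply/eqP/inner_eq0C/PO.
  by apply/esym/eqP; rewrite -subr_eq0 -innerBl PO.
have AP : A^adj *o P = A^adj by rewrite -{1}Psa -(adjoint_comp hK) PAA.
have [C C0 CP] := adjoint_bounded_below hK cA.
pose D := A *o A^adj + (\Id - P).
have C21 : 0 < C ^+ 2 + 1 by rewrite ltr_wpDl ?exprn_ge0// ltW.
have [||W [DW WD]] := @coercive_invertible _ _ hK _ D (C ^+ 2 + 1)^-1.
- by rewrite invr_gt0.
- move=> y; rewrite ler_pdivrMl//.
  have -> : inner (D y) y = `|A^adj y| ^+ 2 + `|y - P y| ^+ 2.
    rewrite -[D y]/(A (A^adj y) + (y - P y)) innerDl (adjointP hK) !sqr_norm_inner.
    by rewrite innerBr (PO y (P y))// subr0.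
  have -> : `|y| ^+ 2 = `|P y| ^+ 2 + `|y - P y| ^+ 2.
    by rewrite -[y in LHS](subrK (P y)) pythagoras ?PO// addrC.
  have : `|P y| ^+ 2 <= C ^+ 2 * `|A^adj y| ^+ 2.
    rewrite -exprMn ler_pXn2r ?nnegrE ?mulr_ge0 ?(ltW C0)//.
    by rewrite (le_trans (CP _ (PA y)))// -[A^adj (P y)]/((A^adj *o P) y) AP.
  move=> le_Py; rewrite mulrDl mul1r mulrDr.
  apply: lerD; last by rewrite lerDr exprn_ge0.
  by rewrite (le_trans le_Py)// lerDl mulr_ge0// exprn_ge0// ltW.
have PD : P *o D = A *o A^adj.
  by rewrite bcompDr bcompBr bcomp1r PP subrr addr0 bcompA PAA.
have DP : D *o P = A *o A^adj.
  by rewrite bcompDl bcompBl bcomp1l PP subrr addr0 -bcompA AP.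
have Dsa : D^adj = D.
  by rewrite !(adjointB hK, adjointD hK, adjoint_comp hK, adjointK hK, adjoint_id hK) Psa.
have Wsa : W^adj = W.
  rewrite -[LHS](bcomp1r) -DW bcompA -{1}Dsa -(adjoint_comp hK) DW.
  by rewrite (adjoint_id hK) bcomp1l.
have AZ : A *o (A^adj *o W) = P by rewrite bcompA -PD -bcompA DW bcomp1r.
exists (A^adj *o W); split.
- by rewrite AZ PAA.
- rewrite -bcompA AZ -bcompA.
  have -> : W *o P = P *o W.
    rewrite -[LHS]bcomp1r -DW bcompA -[W *o P *o D]bcompA PD -DP.
    by rewrite bcompA WD bcomp1l.
  by rewrite bcompA AP.
- by rewrite /self_adjoint AZ.
- by rewrite /self_adjoint !(adjoint_comp hK) (adjointK hK) Wsa bcompA.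
Qed.

Lemma pinv_uniq H G (T : 'B(H, G)) Z Z' : is_pinv T Z -> is_pinv T Z' -> Z = Z'.
Proof.
move=> [TZT ZTZ TZ ZT] [TZT' ZTZ' TZ' ZT'].
have e1 : T *o Z = T *o Z'.
  rewrite -TZ -{1}TZT' -bcompA (adjoint_comp hK) TZ TZ' bcompA.
  by rewrite TZT.
have e2 : Z *o T = Z' *o T.
  rewrite -ZT -{1}TZT' -bcompA bcompA (adjoint_comp hK) ZT ZT'.
  by rewrite -bcompA [T *o _]bcompA TZT.
by rewrite -ZTZ e2 -bcompA e1 bcompA ZTZ'.
Qed.

Lemma pinvP H G (T : 'B(H, G)) : closed_range T -> is_pinv T T^dag.
Proof. by move=> /exists_pinv[Z TZ]; rewrite /pinv; case: xgetP => [//|/(_ Z)]. Qed.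

Lemma pinvE H G (T : 'B(H, G)) Z : is_pinv T Z -> T^dag = Z.
Proof.
move=> TZ; apply: pinv_uniq (TZ); rewrite /pinv; case: xgetP => [//|/(_ Z)].
by [].
Qed.

End MoorePenroseTheory.

(** * The updated operator and the candidate for its inverse *)

(** [B] is the update of [A], [S] the capacitance operator of the
    Sherman-Morrison-Woodbury formula, and [M] the candidate inverse, with
    [T] in the place of an inverse of [S]. *)
Section RankUpdate.
Context (K : numFieldType) (E1 E2 E3 : normedModType K).
Variables (A : 'B(E1, E2)) (Z : 'B(E2, E1)) (U : 'B(E3, E2)) (W : 'B(E1, E3)).
Hypotheses (AZU : A *o Z *o U = U) (WZA : W *o Z *o A = W).
Let S : 'B(E3, E3) := \Id + W *o Z *o U.
Variable T : 'B(E3, E3).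
Let B := A + U *o W.
Let M := Z - Z *o U *o T *o W *o Z.

(** Hence [Z U] carries the kernel of [S] into the kernel of [B]; dually,
    [update_cokernel] makes [W Z] carry the range of [B] into that of [S].  All
    later computations reduce to these two intertwining identities. *)
Lemma update_kernel : B *o Z *o U = U *o S.
Proof. by rewrite /B /S bcompDl bcompDl AZU bcompDr bcomp1r !bcompA. Qed.

Lemma update_cokernel : W *o Z *o B = S *o W.
Proof. by rewrite /B /S bcompDr WZA bcompDl bcomp1l !bcompA. Qed.

Lemma update_mul_candidate : B *o M = A *o Z + U *o (\Id - S *o T) *o W *o Z.
Proof.
rewrite /M bcompBr !bcompA update_kernel /B bcompDl -addrA.
by rewrite bcompBr bcomp1r !bcompBl bcompA.
Qed.

Lemma candidate_mul_update : M *o B = Z *o A + Z *o U *o (\Id - T *o S) *o W.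
Proof.
rewrite /M bcompBl -(bcompA _ Z) -(bcompA _ W) (bcompA W) update_cokernel.
by rewrite /B bcompDr -addrA bcompBr bcomp1r bcompBl !bcompA.
Qed.

Lemma update_candidate_update : A *o Z *o A = A -> S *o T *o S = S ->
  B *o M *o B = B.
Proof.
move=> AZA STS; rewrite update_mul_candidate bcompDl.
rewrite -(bcompA (_ *o W) Z) -(bcompA _ W) (bcompA W) update_cokernel bcompA -(bcompA U).
rewrite bcompBl bcomp1l STS subrr bcomp0r bcomp0l addr0.
by rewrite /B bcompDr AZA bcompA AZU.
Qed.

(** Here alone the product of the two defects of [T] appears: [M] is an outer
    inverse of [B] exactly when that extra term vanishes. *)
Lemma candidate_update_candidate : Z *o A *o Z = Z -> T *o S *o T = T ->
  M *o B *o M =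
  M + Z *o U *o (\Id - T *o S) *o (\Id - S *o T) *o W *o Z.
Proof.
move=> ZAZ TST; rewrite candidate_mul_update bcompDl.
have -> : Z *o A *o M = M by rewrite /M bcompBr !bcompA ZAZ.
have WM : W *o M = (\Id - S *o T) *o W *o Z + T *o W *o Z.
  rewrite /M /S bcompBr !(bcompBl, bcompDl, bcomp1l) opprD addrA addrAC subrK.
  by rewrite !bcompA.
have FT : (\Id - T *o S) *o T = 0 by rewrite bcompBl bcomp1l TST subrr.
rewrite -(bcompA _ W) WM bcompDr !bcompA -(bcompA _ _ T) FT.
by rewrite bcomp0r !bcomp0l addr0.
Qed.

End RankUpdate.

Section RankUpdatePinv.
Context (K : numFieldType) (conj : K -> K) (hK : hilbert_scalars conj).
Implicit Types H G L : hilbertType conj.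

(** A Moore-Penrose inverse factors as [Z Z^adj T^adj] and as
    [T^adj Z^adj Z], so it has the kernel and the range of [T^adj]; this
    lemma uses the kernel, [mul_pinv_eq0] the range. *)
Lemma pinv_mul_eq0 H G L (T : 'B(H, G)) Z (X : 'B(L, G)) :
  is_pinv T Z -> T^adj *o X = 0 -> Z *o X = 0.
Proof.
move=> [_ ZTZ TZ _] TX; rewrite -ZTZ -(bcompA Z) -TZ (adjoint_comp hK).
by rewrite -!bcompA TX !bcomp0r.
Qed.

Lemma mul_pinv_eq0 H G L (T : 'B(H, G)) Z (X : 'B(H, L)) :
  is_pinv T Z -> X *o T^adj = 0 -> X *o Z = 0.
Proof.
move=> [_ ZTZ _ ZT] XT; rewrite -ZTZ bcompA -ZT (adjoint_comp hK).
by rewrite !bcompA XT !bcomp0l.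
Qed.

Lemma self_adjoint_id_sub H (T : 'B(H, H)) : self_adjoint T -> self_adjoint (\Id - T).
Proof. by move=> Tsa; rewrite /self_adjoint (adjointB hK) (adjoint_id hK) Tsa. Qed.

Lemma self_adjointDl H (P T : 'B(H, H)) : self_adjoint P ->
  self_adjoint (P + T) <-> self_adjoint T.
Proof.
move=> Psa; rewrite /self_adjoint (adjointD hK) Psa.
by split=> [/addrI|->].
Qed.

Lemma range_sub_mul_pinv H G L (A : 'B(H, G)) Z (U : 'B(L, G)) : is_pinv A Z ->
  range U `<=` range A -> A *o Z *o U = U.
Proof.
move=> [AZA _ _ _] UA; apply: bop_ext => x /=.
have [y _ <-] := UA (U x) (ex_intro2 _ _ x I erefl).
by rewrite -[A (Z (A y))]/((A *o Z *o A) y) AZA.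
Qed.

Lemma range_sub_adj_pinv_mul H G L (A : 'B(H, G)) Z (V : 'B(L, H)) : is_pinv A Z ->
  range V `<=` range A^adj -> V^adj *o Z *o A = V^adj.
Proof.
move=> [AZA _ _ ZA] VA; suff ZAV : Z *o A *o V = V.
  by rewrite -bcompA -ZA -(adjoint_comp hK) ZAV.
apply: bop_ext => x; have [y _ Ay] := VA (V x) (ex_intro2 _ _ x I erefl).
rewrite -[LHS]/((Z *o A) (V x)) -Ay -ZA -[LHS]/(((Z *o A)^adj *o A^adj) y).
by rewrite -(adjoint_comp hK) bcompA AZA.
Qed.

End RankUpdatePinv.

(** * The equivalence *)

Section Equivalence.
Context (K : numFieldType) (conj : K -> K) (hK : hilbert_scalars conj).
Context (H1 H2 H3 : hilbertType conj).

(** The Penrose equations for [M] against [B = A + U V^adj], read one by one: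
    [B M B = B] always holds, [B M] and [M B] are the orthogonal projectors
    [A Z] and [Z A] plus one of the first two operators on the right, and
    [M B M - M] is the third. *)
Lemma pinv_rank_update_iff (A : 'B(H1, H2)) (U : 'B(H3, H2)) (V : 'B(H3, H1))
    (Z : 'B(H2, H1)) (T : 'B(H3, H3)) :
  let S := \Id + V^adj *o Z *o U in
  let E := \Id - S *o T in
  let F := \Id - T *o S in
  is_pinv A Z -> is_pinv S T -> A *o Z *o U = U -> V^adj *o Z *o A = V^adj ->
  is_pinv (A + U *o V^adj) (Z - Z *o U *o T *o V^adj *o Z) <->
  [/\ self_adjoint (U *o E *o V^adj *o Z),
      self_adjoint (Z *o U *o F *o V^adj)
    & Z *o U *o F *o E *o V^adj *o Z = 0].
Proof.
move=> S E F [AZA ZAZ AZ ZA] [STS TST _ _] AZU VZA; rewrite /is_pinv.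
rewrite update_mul_candidate// candidate_mul_update//.
have BMB := update_candidate_update AZU VZA AZA STS.
have MBM := candidate_update_candidate VZA ZAZ TST.
rewrite update_mul_candidate// in BMB; rewrite candidate_mul_update// in MBM.
have [saE saF] := (self_adjointDl hK (U *o E *o V^adj *o Z) AZ,
                   self_adjointDl hK (Z *o U *o F *o V^adj) ZA).
split=> [[_ MBM0 /saE ? /saF ?]|[/saE ? /saF ? FE0]]; split=> //.
  by move: MBM; rewrite MBM0 -[LHS]addr0 => /addrI.
by rewrite MBM -/E -/F FE0 addr0.
Qed.

(** [Z U F] maps into the kernel of [B] because [B Z U F = U S F = 0], and the
    range of [B^dag] is orthogonal to that kernel, so the left correction acts
    on it as the identity.  Dually [E V^adj Z B = E S V^adj = 0] places
    the range of [Z^adj V E] in the kernel of [B^adj], which is the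
    kernel of [B^dag]. *)
Lemma pinv_absorbs_corrections (A : 'B(H1, H2)) (U : 'B(H3, H2)) (V : 'B(H3, H1))
    (Z Bd : 'B(H2, H1)) (T : 'B(H3, H3)) :
  let S := \Id + V^adj *o Z *o U in
  let E := \Id - S *o T in
  let F := \Id - T *o S in
  is_pinv (A + U *o V^adj) Bd -> is_pinv S T ->
  A *o Z *o U = U -> V^adj *o Z *o A = V^adj ->
  (\Id + Z *o U *o F *o U^adj *o Z^adj) *o Bd *o
  (\Id + Z^adj *o V *o E *o V^adj *o Z) = Bd.
Proof.
move=> S E F pB [STS _ saST saTS] AZU VZA.
have Fsa : F^adj = F by exact: self_adjoint_id_sub.
have Esa : E^adj = E by exact: self_adjoint_id_sub.
have SF : S *o F = 0 by rewrite bcompBr bcomp1r bcompA STS subrr.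
have ES : E *o S = 0 by rewrite bcompBl bcomp1l STS subrr.
have BF : (A + U *o V^adj) *o (Z *o U *o F) = 0.
  by rewrite !bcompA update_kernel// -bcompA SF bcomp0r.
have EB : E *o V^adj *o Z *o (A + U *o V^adj) = 0.
  by rewrite -!bcompA (bcompA V^adj) update_cokernel// bcompA ES bcomp0l.
have FBd : F *o U^adj *o Z^adj *o Bd = 0.
  apply: (mul_pinv_eq0 hK pB).
  by rewrite -[RHS](adjoint0 hK) -BF !(adjoint_comp hK) Fsa !bcompA.
have BdE : Bd *o (Z^adj *o V *o E) = 0.
  apply: (pinv_mul_eq0 hK pB).
  rewrite -[RHS](adjoint0 hK) -EB !(adjoint_comp hK) (adjointK hK) Esa.
  by rewrite !bcompA.
have -> : (\Id + Z *o U *o F *o U^adj *o Z^adj) *o Bd = Bd.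
  by rewrite bcompDl bcomp1l -!bcompA (bcompA F) (bcompA _ Z^adj) FBd !bcomp0r addr0.
rewrite !bcompA in BdE.
by rewrite bcompDr bcomp1r !bcompA BdE !bcomp0l addr0.
Qed.

Lemma invertible_correction (H G : hilbertType conj) (X : 'B(H, G)) (F : 'B(H, H)) :
  F^adj = F -> F *o F = F -> 
  let D := \Id + X *o F *o X^adj in D *o D^inv = \Id /\ D^inv *o D = \Id.
Proof.
move=> Fsa FF; have := invertible_id_add_sqr hK (X *o F).
by rewrite (adjoint_comp hK) Fsa !bcompA -(bcompA X) FF.
Qed.

End Equivalence.

Theorem theorem4p2 (R : realType) (k : scalar_kind)
    (H1 H2 H3 : hilbertType (@conj_scalars R k))
    (A : 'B(H1, H2)) (U : 'B(H3, H2)) (V : 'B(H3, H1)) :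
  let S : 'B(H3, H3) := \Id + V^adj *o A^dag *o U in
  let E : 'B(H3, H3) := \Id - S *o S^dag in
  let F : 'B(H3, H3) := \Id - S^dag *o S in
  closed_range A -> closed_range S -> closed_range (A + U *o V^adj) ->
  range U `<=` range A -> range V `<=` range A^adj ->
  (A + U *o V^adj)^dag =
    (\Id + A^dag *o U *o F *o U^adj *o (A^dag)^adj)^inv
    *o (A^dag - A^dag *o U *o S^dag *o V^adj *o A^dag)
    *o (\Id + (A^dag)^adj *o V *o E *o V^adj *o A^dag)^inv
  <->
  [/\ self_adjoint (U *o E *o V^adj *o A^dag),
      self_adjoint (A^dag *o U *o F *o V^adj)
    & A^dag *o U *o F *o E *o V^adj *o A^dag = 0].
Proof.
move=> S E F cA cS cB UA VA; have hK := hilbert_scalarsP R k.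
have pA := pinvP hK cA; have pS := pinvP hK cS; have pB := pinvP hK cB.
have AZU := range_sub_mul_pinv pA UA; have VZA := range_sub_adj_pinv_mul hK pA VA.
rewrite -(pinv_rank_update_iff hK pA pS AZU VZA).
have corr := pinv_absorbs_corrections hK pB pS AZU VZA.
have [STS _ saST saTS] := pS.
have Fsa : F^adj = F by exact: self_adjoint_id_sub.
have Esa : E^adj = E by exact: self_adjoint_id_sub.
have FF : F *o F = F.
  by rewrite {1}/F bcompBl bcomp1l /F bcompBr bcomp1r -!bcompA (bcompA S) STS subrr subr0.
have EE : E *o E = E.
  by rewrite {1}/E bcompBl bcomp1l /E bcompBr bcomp1r !bcompA STS subrr subr0.
have := invertible_correction hK (A^dag *o U) Fsa FF.
have := invertible_correction hK (A^dag^adj *o V) Esa EE.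
rewrite !(adjoint_comp hK) (adjointK hK) !bcompA.
set D2 := \Id + A^dag^adj *o _ *o _ *o _ *o _; set D1 := \Id + A^dag *o _ *o _ *o _ *o _.
move=> [D2V VD2] [D1V VD1].
set M := A^dag - _.
split=> [BdM|pM].
  suff <- : (A + U *o V^adj)^dag = M by [].
  by rewrite -[LHS]corr BdM !bcompA D1V bcomp1l -bcompA VD2 bcomp1r.
by rewrite -(pinvE hK pM) -[in RHS]corr !bcompA VD1 bcomp1l -bcompA D2V bcomp1r.
Qed.
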